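(* Let $n$ be a positive integer. The map $\mathcal{C}:\{\text{abaci}\}\to\{\text{partitions}\}$ restricts to a bijection from the set of balanced flush abaci onto the set of symmetric $(2n)$-core partitions (types $\widetilde{C}/C$ and $\widetilde{B}/D$), and to a bijection from the set of even balanced flush abaci onto the set of even symmetric $(2n)$-core partitions (types $\widetilde{B}/B$ and $\widetilde{D}/D$).
   Context: Let $N=2n+1$. An abacus has $2n$ columns called runners $1,\dots,2n$; runner $i$ has entries labeled $mN+i$ for each level $m\in\mathbb{Z}$ (so the entries are the integers not divisible by $N$). Some entries are circled (beads); the others are gaps. Reading order is the order of the labels; ''lowest'' means largest label. The abacus is flush if no bead is preceded in reading order by a gap on the same runner. It is balanced if every runner has at least one bead and, for all $1\le i\le 2n$, the labels of the lowest beads on runners $i$ and $N-i$ sum to $N$. It is even if the number of gaps preceding $N$ in reading order is even. A bead is active if some gap (on any runner) precedes it in reading order. Partitions are identified with their diagrams ($\lambda_i$ boxes in row $i$, first row at the top). A partition is a $(2n)$-core if no box has hook length divisible by $2n$; symmetric if for every $i$ the length of its $i$-th row equals the length of its $i$-th column; even if it has an even number of boxes on the main diagonal. For an abacus $a$, $\mathcal{C}(a)$ is the partition whose southeast boundary is the lattice path obtained by reading the entries of $a$ in reading order, recording a north-step for each bead and an east-step for each gap. Equivalently, if $a$ has $M$ active beads, the $i$-th row of $\mathcal{C}(a)$ has as many boxes as there are gaps before the $(M-i+1)$-st active bead in reading order. *)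

(* Defs.v *)
From mathcomp Require Import all_boot all_order all_algebra.
From mathcomp Require Import finmap.
From mathcomp Require Import boolp classical_sets functions cardinality.

Set Implicit Arguments.
Unset Strict Implicit.
Unset Printing Implicit Defensive.

Import Order.TTheory GRing.Theory Num.Theory.

Local Open Scope classical_set_scope.
Local Open Scope ring_scope.

(* A position on the abacus is a pair (level, runner). Runners are numbered
   from 0, so the runner i : 'I_(2 * n) is the (i+1)-st runner, and rev_ord i
   is the runner numbered N - (i+1) when counting from 1. *)
Definition entry (n : nat) : choiceType := (int * 'I_(2 * n))%type.

Definition abacus_N (n : nat) : int := (2 * n).+1%:Z.

Definition label n (e : entry n) : int := e.1 * abacus_N n + e.2.+1%:Z.

(* An abacus is identified with its set of beads. *)
Definition abacus (n : nat) : Type := set (entry n).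

Definition bead n (a : abacus n) (e : entry n) : Prop := a e.

Definition gap n (a : abacus n) (e : entry n) : Prop := ~ bead a e.

Definition precedes n (e f : entry n) : Prop := label e < label f.

Definition flush n (a : abacus n) : Prop :=
  forall e f : entry n,
    bead a e -> gap a f -> f.2 = e.2 -> ~ precedes f e.

Definition lowest_bead n (a : abacus n) (i : 'I_(2 * n)) (e : entry n) : Prop :=
  [/\ bead a e, e.2 = i &
      forall f : entry n, bead a f -> f.2 = i -> label f <= label e].

Definition balanced n (a : abacus n) : Prop :=
  (forall i : 'I_(2 * n), exists e : entry n, bead a e /\ e.2 = i) /\
  (forall i : 'I_(2 * n), exists e f : entry n,
     [/\ lowest_bead a i e, lowest_bead a (rev_ord i) f &
         label e + label f = abacus_N n]).

Definition gaps_before n (a : abacus n) (z : int) : set (entry n) :=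
  [set e | gap a e /\ label e < z].

Definition even_abacus n (a : abacus n) : Prop :=
  finite_set (gaps_before a (abacus_N n)) /\
  ~~ odd #|` fset_set (gaps_before a (abacus_N n))|%fset.

Definition active_beads n (a : abacus n) : set (entry n) :=
  [set e | bead a e /\ exists f : entry n, gap a f /\ precedes f e].

(* The sequence of row lengths of C(a), from the top row down: the active beads
   are listed from last to first in reading order. This is meaningful when there
   are finitely many active beads and each of them is preceded by finitely many
   gaps, as is the case for balanced flush abaci; fset_set sends an infinite set
   to the empty one. *)
Definition abacus_partition n (a : abacus n) : seq nat :=
  [seq #|` fset_set (gaps_before a (label e))|%fset
     | e <- sort (fun e f : entry n => label f <= label e)
                 (fset_set (active_beads a))].

(* Partitions are sequences of positive row lengths; rows and columns are
   numbered from 0. *)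
Definition is_partition (l : seq nat) : bool :=
  sorted geq l && all (ltn 0%N) l.

Definition row_length (l : seq nat) (i : nat) : nat := nth 0%N l i.

Definition column_length (l : seq nat) (j : nat) : nat := count (ltn j) l.

Definition in_diagram (l : seq nat) (i j : nat) : bool :=
  (j < row_length l i)%N.

Definition hook_length (l : seq nat) (i j : nat) : nat :=
  ((row_length l i - j.+1) + (column_length l j - i.+1)).+1.

Definition is_core (d : nat) (l : seq nat) : Prop :=
  forall i j : nat, in_diagram l i j -> ~~ (d %| hook_length l i j)%N.

Definition symmetric_partition (l : seq nat) : Prop :=
  forall i : nat, row_length l i = column_length l i.

Definition even_partition (l : seq nat) : Prop :=
  ~~ odd (count (fun i => in_diagram l i i) (iota 0 (size l))).

Definition balanced_flush_abaci (n : nat) : set (abacus n) :=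
  [set a | balanced a /\ flush a].

Definition even_balanced_flush_abaci (n : nat) : set (abacus n) :=
  [set a | [/\ even_abacus a, balanced a & flush a]].

Definition symmetric_cores (d : nat) : set (seq nat) :=
  [set l | [/\ is_partition l, symmetric_partition l & is_core d l]].

Definition even_symmetric_cores (d : nat) : set (seq nat) :=
  [set l | [/\ is_partition l, even_partition l,
               symmetric_partition l & is_core d l]].

Arguments balanced_flush_abaci : clear implicits.
Arguments even_balanced_flush_abaci : clear implicits.

(* Main.v *)
(* The boundary path of a partition [l] consists of steps indexed by the integers:
   the bead (north) steps are at [x_i = l_i - i - 1] and the gap (east) steps at
   [y_j = j - l'_j], where [l'] is the conjugate partition. A box [(i, j)] has
   hook length [x_i - y_j], so [l] is a [2n]-core exactly when no gap precedes a
   bead in the same class modulo [2n], i.e. on the same runner. Conjugation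
   reverses the path, so [l] is symmetric exactly when [q |-> -1 - q] exchanges
   beads and gaps; on flush abaci this is the balance condition. The gaps at
   [q < 0] correspond to the boxes on the main diagonal of a symmetric [l]. *)
Require Import Defs.
From mathcomp Require Import all_boot all_order all_algebra zify.
From mathcomp Require Import finmap boolp classical_sets functions cardinality.

Set Implicit Arguments.
Unset Strict Implicit.
Unset Printing Implicit Defensive.

Import Order.TTheory GRing.Theory Num.Theory.

Local Open Scope ring_scope.

(** * Row and column lengths of a partition *)

Lemma geq_trans : transitive geq.
Proof. by move=> y x z /= xy yz; apply: leq_trans yz xy. Qed.

(** In a nonincreasing sequence the rows longer than [j] come first, so counting them locates the
    first row that is too short. *)
Lemma ltn_column_length (l : seq nat) (i j : nat) :
  sorted geq l -> (i < column_length l j)%N = (j < row_length l i)%N.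
Proof.
rewrite /column_length /row_length.
elim: l i => [|x l IHl] i; first by rewrite nth_nil.
rewrite /= (path_sortedE geq_trans) => /andP[/allP lx /IHl{}IHl].
case: i => [|i] /=; last first.
  rewrite -IHl; case: (ltnP j x) => //= xj; rewrite ?add1n ?add0n //.
  suff -> : count (ltn j) l = 0%N by [].
  apply/eqP; rewrite -leqn0 leqNgt -has_count -all_predC.
  by apply/allP => y /lx /= yx; rewrite -leqNgt (leq_trans yx xj).
case: (ltnP j x) => //= xj; rewrite add0n.
apply/negbTE; rewrite -has_count -all_predC.
by apply/allP => y /lx /= yx; rewrite -leqNgt (leq_trans yx xj).
Qed.

Lemma nonincreasing_row_length (l : seq nat) (i j : nat) :
  sorted geq l -> (i <= j)%N -> (row_length l j <= row_length l i)%N.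
Proof.
move=> sl ij; rewrite leqNgt; apply/negP => lt_ij.
have := lt_ij; rewrite -ltn_column_length // => j_col.
by have := leq_ltn_trans ij j_col; rewrite ltn_column_length // ltnn.
Qed.

Lemma row_length_gt0 (l : seq nat) (i : nat) :
  is_partition l -> (0 < row_length l i)%N = (i < size l)%N.
Proof.
case/andP=> _ /allP l_gt0; rewrite /row_length.
case: (ltnP i (size l)) => il; last by rewrite nth_default.
by apply/l_gt0/mem_nth.
Qed.

(** The zeros are trailing, and [nth] returns the default 0 once they are removed. *)
Lemma nth_filter_gt0 (l : seq nat) (i : nat) :
  sorted geq l -> nth 0%N (filter (ltn 0) l) i = nth 0%N l i.
Proof.
elim: l i => [|x l IHl] i //=.
rewrite (path_sortedE geq_trans) => /andP[/allP lx /IHl{}IHl].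
case: x lx => [|x] lx /=; last by case: i.
rewrite IHl; case: i => [|i] /=.
  by apply/eqP; rewrite -leqn0; case: l lx {IHl} => //= y l; apply; rewrite mem_head.
have l0 k : nth 0%N l k = 0%N.
  case: (ltnP k (size l)) => kl; last by rewrite nth_default.
  by apply/eqP; rewrite -leqn0; apply/lx/mem_nth.
by rewrite !l0.
Qed.

(** * Steps of the boundary path *)

(* A partition is encoded by its boundary path, whose steps are indexed by the
   integers so that the steps of index < 0 and >= 0 lie on the two sides of the
   main diagonal: row [i] ends with the step [bead_pos l i], and column [j] with
   the step [gap_pos l j]. *)
Definition bead_pos (l : seq nat) (i : nat) : int :=
  (row_length l i)%:Z - i.+1%:Z.

Definition gap_pos (l : seq nat) (j : nat) : int :=
  j%:Z - (column_length l j)%:Z.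

Lemma nonincreasing_column_length (l : seq nat) (i j : nat) :
  (i <= j)%N -> (column_length l j <= column_length l i)%N.
Proof. by move=> ij; apply: sub_count => x /=; apply: leq_ltn_trans. Qed.

Lemma gap_pos_incr (l : seq nat) (i j : nat) : (i < j)%N -> gap_pos l i < gap_pos l j.
Proof.
move=> ij; have := nonincreasing_column_length l (ltnW ij).
by rewrite /gap_pos; lia.
Qed.

Section Boundary.
Variable l : seq nat.
Hypothesis sorted_l : sorted geq l.

(** The difference of the positions is [(l_i - j) + (l'_j - i) - 1]. Both brackets are positive
    inside the diagram and nonpositive outside it, so the difference never vanishes. *)
Lemma gap_pos_ltE (i j : nat) : (gap_pos l j < bead_pos l i) = in_diagram l i j.
Proof.
rewrite /in_diagram /gap_pos /bead_pos.
have := ltn_column_length i j sorted_l.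
by case: (ltnP j (row_length l i)) => h1 h2; lia.
Qed.

Lemma hook_lengthE (i j : nat) : in_diagram l i j ->
  (hook_length l i j)%:Z = bead_pos l i - gap_pos l j.
Proof.
rewrite /in_diagram /hook_length /gap_pos /bead_pos => lij.
have := ltn_column_length i j sorted_l.
by rewrite lij => ?; lia.
Qed.

Lemma bead_pos_decr (i j : nat) : (i < j)%N -> bead_pos l j < bead_pos l i.
Proof.
move=> ij; have := nonincreasing_row_length sorted_l (ltnW ij).
by rewrite /bead_pos; lia.
Qed.

Lemma bead_pos_neq_gap_pos (i j : nat) : bead_pos l i <> gap_pos l j.
Proof.
rewrite /gap_pos /bead_pos; have := ltn_column_length i j sorted_l.
by case: (ltnP j (row_length l i)) => h1 h2; lia.
Qed.

Lemma bead_pos_or_gap_pos (q : int) :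
  (exists i, q = bead_pos l i) \/ (exists j, q = gap_pos l j).
Proof.
(* The least [i] with [bead_pos l i <= q] decides the case. If equality fails, column [j = q + i]
   has length exactly [i]: row [i] does not reach it, while row [i - 1], if there is one, does by
   minimality. *)
have exi : exists i, (row_length l i)%:Z <= q + i.+1%:Z.
  exists (`|q| + row_length l 0)%N.
  have := nonincreasing_row_length sorted_l (leq0n (`|q| + row_length l 0)%N).
  lia.
case: (ex_minnP exi) => i i_le i_min.
have [eq_i|lt_i] : (row_length l i)%:Z = q + i.+1%:Z \/
    (row_length l i)%:Z < q + i.+1%:Z by lia.
  by left; exists i; rewrite /bead_pos; lia.
right; have [j qj] : exists j : nat, j%:Z = q + i%:Z.
  by exists (absz (q + i%:Z)); lia.
exists j; have := ltn_column_length i j sorted_l.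
case: i i_le lt_i i_min qj => [|i] i_le lt_i i_min qj hi;
  first by rewrite /gap_pos; lia.
have := ltn_column_length i j sorted_l.
have : (j < row_length l i)%N.
  by rewrite ltnNge; apply/negP => ?; have := i_min i; lia.
by rewrite /gap_pos; lia.
Qed.

Lemma bead_posPn (q : int) :
  ~ (exists i, q = bead_pos l i) <-> exists j, q = gap_pos l j.
Proof.
split; first by case: (bead_pos_or_gap_pos q).
by case=> j -> [i] /esym; apply: bead_pos_neq_gap_pos.
Qed.

End Boundary.

(** * Symmetry, cores and reconstruction of a partition from its boundary path *)

Lemma incr_enum_uniq (f g : nat -> int) :
    {homo f : i j / (i < j)%N >-> i < j} ->
    {homo g : i j / (i < j)%N >-> i < j} ->
    (forall i, exists j, f i = g j) -> (forall j, exists i, g j = f i) ->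
  f =1 g.
Proof.
move=> fI gI fg gf i; elim/ltn_ind: i => i IHi.
have [j fj] := fg i; have [k gk] := gf i.
case: (ltngtP i j) => [ij|ji|ij]; [|exfalso|by rewrite fj ij]; last first.
  by have := fI _ _ ji; rewrite (IHi _ ji) fj ltxx.
case: (ltngtP i k) => [ik|ki|ik]; last by rewrite gk ik.
  by have := gI _ _ ij; have := fI _ _ ik; rewrite gk -fj => /lt_trans h /h; rewrite ltxx.
by have := gI _ _ ki; rewrite -(IHi _ ki) gk ltxx.
Qed.

Lemma symmetric_partitionP (l : seq nat) : sorted geq l ->
  symmetric_partition l <->
  forall q, (exists i, - 1 - q = bead_pos l i) <-> ~ (exists i, q = bead_pos l i).
Proof.
move=> sl; split=> [l_sym q|l_sym].
  have gapE j : gap_pos l j = - 1 - bead_pos l j.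
    by rewrite /gap_pos -l_sym /bead_pos; lia.
  apply: iff_trans (iff_sym (bead_posPn sl q)).
  by split=> -[i qi]; exists i; move: qi; rewrite gapE; lia.
(* Gaps and reflected beads are two increasing enumerations of the same set, hence agree index by
   index. *)
have gapE : gap_pos l =1 fun i => - 1 - bead_pos l i.
  apply: incr_enum_uniq => [i j|i j ij|i|i].
  - exact: gap_pos_incr.
  - by have := bead_pos_decr sl ij; lia.
  - have /l_sym[j] : ~ exists j, gap_pos l i = bead_pos l j.
      by apply/bead_posPn => //; exists i.
    by exists j; lia.
  - by apply/(bead_posPn sl)/(proj1 (l_sym _)); exists i; lia.
by move=> i; have := gapE i; rewrite /gap_pos /bead_pos; lia.
Qed.

Lemma is_coreP (d : nat) (l : seq nat) : sorted geq l ->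
  is_core d l <->
  forall p q, (exists i, p = bead_pos l i) -> ~ (exists i, q = bead_pos l i) ->
    (d%:Z %| p - q)%Z -> p <= q.
Proof.
move=> sl; split=> [core p q [i ->] /(bead_posPn sl)[j ->] dvd_ij|flush_l i j lij].
  rewrite leNgt; apply/negP; rewrite gap_pos_ltE // => lij.
  have := core i j lij; rewrite -[X in ~~ X]/(d%:Z %| (hook_length l i j)%:Z)%Z.
  by rewrite hook_lengthE // dvd_ij.
apply/negP => dvd_ij.
have : bead_pos l i <= gap_pos l j.
  apply: flush_l; first by exists i.
    by apply/bead_posPn => //; exists j.
  by rewrite -hook_lengthE.
by rewrite leNgt gap_pos_ltE // lij.
Qed.

(** Let [s_0 > s_1 > ...] be the beads in the window [[-K, K)]; row [i] gets length [s_i + i + 1].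
    Symmetry leaves no bead above the window and puts exactly [K] in it, so the beads below it end
    the empty rows of index at least [K]. *)
Lemma maya_partition (b : int -> bool) (K : nat) :
    (forall q, b (- 1 - q) = ~~ b q) -> (forall q, q < - K%:Z -> b q) ->
  exists2 l, is_partition l & forall q, b q <-> exists i, q = bead_pos l i.
Proof.
move=> b_sym b_low.
pose p (k : nat) : int := K%:Z - k.+1%:Z.
have p_inj : injective p by move=> x y; rewrite /p; lia.
pose s := filter b [seq p k | k <- iota 0 (2 * K)].
have s_mem q : (q \in s) = b q && (- K%:Z <= q).
  rewrite mem_filter; case bq: (b q) => //=.
  apply/mapP/idP => [[k]|Kq]; first by rewrite mem_iota /p => ? ->; lia.
  have qK : q < K%:Z.
    rewrite ltNge; apply/negP => Kq'; have : b (- 1 - q) by apply: b_low; lia.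
    by rewrite b_sym bq.
  by exists (absz (K%:Z - 1 - q)%R); rewrite ?mem_iota /p; lia.
have s_sorted : sorted (fun x y : int => y < x) s.
  apply: sorted_filter; first by move=> y x z yx zy; apply: lt_trans zy yx.
  apply: (homo_sorted (e := ltn)) (iota_ltn_sorted _ _) => x y.
  by rewrite /p /=; lia.
have s_size : size s = K.
  rewrite size_filter count_map -[RHS]/K.
  (* The symmetry exchanges beads and gaps of the window [-K, K). *)
  have : (count (preim p b) (iota 0 (2 * K)) +
          count (preim p b) (iota 0 (2 * K)) = 2 * K)%N.
    rewrite -[RHS](size_iota 0) -[RHS](count_predC (preim p b)); congr addn.
    have rev_iota : perm_eq (iota 0 (2 * K))
        [seq (2 * K).-1 - k | k <- iota 0 (2 * K)]%N.
      apply: uniq_perm; rewrite ?iota_uniq //.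
        rewrite map_inj_in_uniq ?iota_uniq // => x y.
        by rewrite !mem_iota; lia.
      move=> x; apply/idP/mapP => [|[y]]; rewrite !mem_iota; last by move=> ? ->; lia.
      by exists ((2 * K).-1 - x)%N; rewrite ?mem_iota; lia.
    rewrite (permP rev_iota) count_map.
    apply: eq_in_count => k; rewrite mem_iota => k_lt /=.
    by rewrite -b_sym; congr b; rewrite /p; lia.
  by rewrite addnn -mul2n => /eqP; rewrite eqn_pmul2l // => /eqP.
have nth_decr i j : (i < j < K)%N -> nth 0 s j < nth 0 s i.
  case/andP=> ij jK; have tr : transitive (fun x y : int => y < x).
    by move=> y x z yx zy; apply: lt_trans zy yx.
  by apply: (sorted_ltn_nth tr 0 s_sorted); rewrite // inE s_size; lia.
(* Descending induction from the last bead, which is at least [-K]. It makes the row lengths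
   nonnegative, so [absz] below is harmless. *)
have nth_ge k i : (i + k.+1 = K)%N -> - i.+1%:Z <= nth 0 s i.
  elim: k i => [|k IHk] i ik.
    have : nth 0 s i \in s by apply: mem_nth; rewrite s_size; lia.
    by rewrite s_mem => /andP[_]; lia.
  have := IHk i.+1; have := nth_decr i i.+1; rewrite ltnSn; lia.
pose r := [seq absz (nth 0 s i + i.+1%:Z)%R | i <- iota 0 K].
have nth_r i : (i < K)%N -> (nth 0%N r i)%:Z = nth 0 s i + i.+1%:Z.
  move=> iK; rewrite (nth_map 0%N) ?size_iota // nth_iota // add0n.
  by have := nth_ge (K - i.+1)%N i; lia.
have r_size : size r = K by rewrite size_map size_iota.
have r_sorted : sorted geq r.
  apply/(sortedP 0%N) => i; rewrite r_size => iK.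
  by have := nth_r i; have := nth_r i.+1; have := nth_decr i i.+1; rewrite /=; lia.
exists (filter (ltn 0) r).
  rewrite /is_partition filter_all andbT.
  by apply: sorted_filter => //; apply: geq_trans.
move=> q; rewrite /bead_pos /row_length; split=> [bq|[i ->]].
  case: (leP (- K%:Z) q) => Kq.
    have qs : q \in s by rewrite s_mem bq.
    have := qs; rewrite -index_mem s_size => ltK.
    exists (index q s); rewrite nth_filter_gt0 // nth_r // nth_index //; lia.
  exists (absz (- 1 - q)%R); rewrite nth_filter_gt0 // nth_default ?r_size; lia.
rewrite nth_filter_gt0 //; case: (ltnP i K) => iK.
  have : nth 0 s i \in s by rewrite mem_nth ?s_size.
  by rewrite nth_r // addrK s_mem => /andP[].
by rewrite nth_default ?r_size //; apply: b_low; lia.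
Qed.

Local Open Scope classical_set_scope.

(** * Auxiliary facts on finite sets and integers *)

Lemma fset_set_seq (T : choiceType) (s : seq T) :
  fset_set [set` s] = [fset x in s]%fset.
Proof. by apply/fsetP => x; rewrite in_fset_set ?inE //= mem_setE. Qed.

Lemma int_max (P : int -> Prop) (m0 M : int) :
  P m0 -> (forall m, P m -> m <= M) -> exists2 c, P c & forall m, P m -> m <= c.
Proof.
move=> Pm0 PM.
have exP : exists k : nat, `[< P (m0 + k%:Z) >].
  by exists 0%N; rewrite addr0; apply/asboolP.
have ubP k : `[< P (m0 + k%:Z) >] -> (k <= absz (M - m0)%R)%N.
  by move=> /asboolP/PM; lia.
case: (ex_maxnP exP ubP) => k /asboolP Pk kmax.
exists (m0 + k%:Z) => // m Pm; case: (leP m m0) => mm0; first lia.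
have := kmax (absz (m - m0)%R).
by rewrite gez0_abs ?subr_ge0 ?(ltW mm0) // subrKC => /(_ (asboolT Pm)); lia.
Qed.

(** Base [2n + 1] gives labels and base [2n] gives positions, so both order entries by level, then
    by runner. *)
Lemma ltr_lex (k : nat) (m m' : int) (r r' : nat) : (r < k)%N -> (r' < k)%N ->
  (m * k%:Z + r%:Z < m' * k%:Z + r'%:Z) = (m < m') || (m == m') && (r < r')%N.
Proof.
move=> rk r'k; case: (ltgtP m m') => [lt_m|gt_m|->] /=; last by rewrite ltrD2l.
  have : 0 <= (m' - m - 1) * k%:Z by apply: mulr_ge0; lia.
  by move=> ?; apply/idP; nia.
have : 0 <= (m - m' - 1) * k%:Z by apply: mulr_ge0; lia.
by move=> ?; apply/negP; nia.
Qed.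

(** * Reading order and the reflection of the abacus *)

Section Positions.
Variable n : nat.
Hypothesis n_gt0 : (0 < n)%N.
Implicit Types (a : abacus n) (e f : entry n) (l : seq nat).

(* The index of an entry in reading order, counted from the first entry after
   the label [abacus_N n]; this makes [C(a)] straddle its main diagonal there. *)
Definition pos e : int := (e.1 - 1) * (2 * n)%N%:Z + (e.2 : nat)%:Z.

Definition entry_at (q : int) : entry n :=
  ((q %/ (2 * n)%N%:Z)%Z + 1,
   Ordinal (ltn_pmod (absz (q %% (2 * n)%N%:Z)%Z) (leq_mul (ltn0Sn 1) n_gt0))).

Lemma entry_atK : cancel entry_at pos.
Proof.
move=> q; rewrite /pos /= addrK modn_small.
  by rewrite gez0_abs ?modz_ge0 -?divz_eq //; lia.
have := @ltz_pmod q (2 * n)%N%:Z; have := @modz_ge0 q (2 * n)%N%:Z; lia.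
Qed.

Lemma label_ltE e f : (label e < label f) = (pos e < pos f).
Proof.
rewrite /label /pos /abacus_N !ltr_lex ?ltnS //.
by rewrite ltrD2r (inj_eq (addIr _)).
Qed.

Lemma pos_inj : injective pos.
Proof.
case=> m i [m' i'] eq_p; have := ltxx (pos (m, i)).
rewrite {2}eq_p ltr_lex // => h1; have := ltxx (pos (m, i)).
rewrite {1}eq_p ltr_lex //= => h2; rewrite /= in h1.
have mm' : m = m' by lia.
by rewrite mm'; congr pair; apply: val_inj; rewrite /=; lia.
Qed.

Lemma posK : cancel pos entry_at.
Proof. by move=> e; apply: pos_inj; rewrite entry_atK. Qed.

Lemma label_leE e f : (label e <= label f) = (pos e <= pos f).
Proof. by rewrite !leNgt label_ltE. Qed.

Lemma ltr_label_runner (m m' : int) (i : 'I_(2 * n)) :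
  (label (m, i) < label (m', i)) = (m < m').
Proof. by rewrite ltr_lex ?ltnS // ltnn andbF orbF. Qed.

Lemma ler_label_runner (m m' : int) (i : 'I_(2 * n)) :
  (label (m, i) <= label (m', i)) = (m <= m').
Proof. by rewrite !leNgt ltr_label_runner. Qed.

(** The label [N] and the position 0 both have remainder 0 in their bases, so each comparison only
    tests whether the level is below 1. *)
Lemma label_ltNE e : (label e < abacus_N n) = (pos e < 0).
Proof.
have := @ltr_lex (2 * n).+1 e.1 1 e.2.+1 0 (ltn_ord e.2) isT.
have := @ltr_lex (2 * n) (e.1 - 1) 0 e.2 0 (ltn_ord e.2)
  (leq_ltn_trans (leq0n _) (ltn_ord e.2)).
rewrite !ltn0 !andbF !orbF mul1r mul0r !addr0 /label /pos /abacus_N => -> ->.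
by lia.
Qed.

Lemma dvd_posB e f : ((2 * n)%N%:Z %| pos e - pos f)%Z = (e.2 == f.2).
Proof.
by rewrite -eqz_mod_dvd /pos !modzMDl !modz_small ?lez_nat ?ltz_nat ?ltn_ord.
Qed.

(** On labels this is the reflection [z |-> 2N - z] about [N]. *)
Definition mirror e : entry n := (1 - e.1, rev_ord e.2).

Lemma pos_mirror e : pos (mirror e) = - 1 - pos e.
Proof.
case: e => m i; rewrite /pos /mirror /=.
by have := ltn_ord i; nia.
Qed.

(** * The abacus of a partition, inverse to [abacus_partition] *)

Definition abacus_of l : abacus n := [set e | exists i, pos e = bead_pos l i].

Section AbacusOf.
Variable l : seq nat.
Hypothesis sorted_l : sorted geq l.

Lemma gap_abacus_of e : gap (abacus_of l) e <-> exists j, pos e = gap_pos l j.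
Proof. exact: bead_posPn. Qed.

(** The threshold is given both as a label [z] and as a position [w], because it is used at [N],
    which labels no entry, as well as at beads. *)
Lemma gaps_before_abacus_of (z w : int) (s : seq nat) :
    (forall e, (label e < z) = (pos e < w)) ->
    (forall j, (gap_pos l j < w) = (j \in s)) ->
  gaps_before (abacus_of l) z = [set` [seq entry_at (gap_pos l j) | j <- s]].
Proof.
move=> zw ws; apply/seteqP; split=> e /=.
  move=> [/gap_abacus_of[j ej]]; rewrite zw ej ws => js.
  by apply/mapP; exists j => //; rewrite -ej posK.
move=> /mapP[j js ->]; split; last by rewrite zw entry_atK ws.
by apply/gap_abacus_of; exists j; rewrite entry_atK.
Qed.

Lemma card_gaps_before (z w : int) (s : seq nat) :
    (forall e, (label e < z) = (pos e < w)) ->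
    (forall j, (gap_pos l j < w) = (j \in s)) -> uniq s ->
  #|` fset_set (gaps_before (abacus_of l) z)|%fset = size s.
Proof.
move=> zw ws s_uniq; rewrite (gaps_before_abacus_of zw ws) fset_set_seq card_fseq.
rewrite undup_id ?size_map // map_inj_uniq // => i j /(can_inj entry_atK) ij.
by case: (ltngtP i j) => // /(gap_pos_incr l); rewrite ij ltxx.
Qed.

Lemma flush_abacus_of : flush (abacus_of l) <-> is_core (2 * n) l.
Proof.
rewrite is_coreP //; split=> [fl p q bp bq dvd_pq|core e f be ge ef].
  rewrite leNgt; apply/negP => qp.
  apply: (fl (entry_at p) (entry_at q)).
  - by rewrite /bead /abacus_of /= entry_atK.
  - by rewrite /gap /bead /abacus_of /= entry_atK.
  - by apply/esym/eqP; rewrite -dvd_posB !entry_atK.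
  - by rewrite /precedes label_ltE !entry_atK.
rewrite /precedes label_ltE ltNge => /negP; apply.
by apply: core => //; rewrite dvd_posB ef.
Qed.

(** A gap has negative position when [j < l'_j]; by symmetry this is [j < l_j], a diagonal box. *)
Lemma even_abacus_of : is_partition l -> symmetric_partition l ->
  even_abacus (abacus_of l) <-> even_partition l.
Proof.
move=> pl l_sym; rewrite /even_abacus /even_partition.
pose s := [seq j <- iota 0 (size l) | in_diagram l j j].
have ws j : (gap_pos l j < 0) = (j \in s).
  rewrite mem_filter mem_iota -row_length_gt0 // /in_diagram /gap_pos -l_sym.
  by lia.
rewrite (card_gaps_before label_ltNE ws) ?filter_uniq ?iota_uniq // size_filter.
rewrite (gaps_before_abacus_of label_ltNE ws).
by split=> [[]//|]; split=> //; apply: finite_seq.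
Qed.

End AbacusOf.

Lemma abacus_of_partitionK l : is_partition l -> abacus_partition (abacus_of l) = l.
Proof.
move=> pl; have sl : sorted geq l by case/andP: pl.
have beads_eq : active_beads (abacus_of l) =
    [set` [seq entry_at (bead_pos l i) | i <- iota 0 (size l)]].
  apply/seteqP; split=> e /=.
    move=> [[i ei] [f [/(gap_abacus_of sl)[j fj]]]].
    rewrite /precedes label_ltE ei fj gap_pos_ltE // /in_diagram => lij.
    apply/mapP; exists i; last by rewrite -ei posK.
    by rewrite mem_iota -row_length_gt0 //; lia.
  move=> /mapP[i]; rewrite mem_iota add0n -row_length_gt0 // => li ->; split.
    by exists i; rewrite entry_atK.
  (* The first gap of all precedes exactly the beads of nonempty rows. *)
  exists (entry_at (gap_pos l 0)); split.
    by apply/(gap_abacus_of sl); exists 0%N; rewrite entry_atK.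
  by rewrite /precedes label_ltE !entry_atK gap_pos_ltE.
rewrite /abacus_partition beads_eq fset_set_seq.
set leT := fun e f : entry n => label f <= label e.
have leT_trans : transitive leT by move=> y x z xy yz; apply: le_trans yz xy.
have leT_total : total leT by move=> x y; apply: le_total.
have leT_anti : antisymmetric leT.
  by move=> x y; rewrite /leT !label_leE -eq_le => /eqP/pos_inj.
have sorted_beads : sorted leT [seq entry_at (bead_pos l i) | i <- iota 0 (size l)].
  apply: (homo_sorted (e := ltn)) (iota_ltn_sorted _ _) => i j ij.
  by rewrite /leT label_leE !entry_atK; apply/ltW/bead_pos_decr.
have uniq_beads : uniq [seq entry_at (bead_pos l i) | i <- iota 0 (size l)].
  rewrite map_inj_uniq ?iota_uniq // => i j /(can_inj entry_atK) ij.
  by case: (ltngtP i j) => // /(bead_pos_decr sl); rewrite ij ltxx.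
have -> : sort leT
      [fset x in [seq entry_at (bead_pos l i) | i <- iota 0 (size l)]]%fset =
    [seq entry_at (bead_pos l i) | i <- iota 0 (size l)].
  apply: (sorted_eq leT_trans leT_anti) => //; first exact: sort_sorted.
  rewrite perm_sort; apply: uniq_perm => // x.
  by rewrite !inE.
rewrite -map_comp -[RHS](mkseq_nth 0%N) /mkseq; apply: eq_map => i /=.
(* The gaps before the bead of row [i] are those of the columns [j < l_i]. *)
rewrite (card_gaps_before sl (w := bead_pos l i) (s := iota 0 (nth 0%N l i))).
- by rewrite size_iota.
- by move=> e; rewrite label_ltE entry_atK.
- by move=> j; rewrite gap_pos_ltE // mem_iota.
- exact: iota_uniq.
Qed.

(** * Balance as exchange of beads and gaps under [mirror] *)

Lemma balanced_abacus_of l : sorted geq l -> symmetric_partition l ->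
  flush (abacus_of l) -> balanced (abacus_of l).
Proof.
move=> sl /(symmetric_partitionP sl) l_sym fl.
have mirrorE e : abacus_of l (mirror e) <-> ~ abacus_of l e.
  by rewrite /abacus_of /= pos_mirror; apply: l_sym.
have bead_ub m i : abacus_of l (m, i) -> m <= (row_length l 0)%:Z + 1.
  move=> [k mik]; have := nonincreasing_row_length sl (leq0n k).
  by move: mik; rewrite /pos /bead_pos /= => ? ?; nia.
have ex_bead i : exists m, abacus_of l (m, i).
  (* If this entry were a gap, its mirror would be a bead at level [l_0 + 2], above the bound
     [bead_ub]. *)
  have [mi|] := pselect (abacus_of l (- (row_length l 0)%:Z - 1, i)).
    by exists (- (row_length l 0)%:Z - 1).
  by move=> /mirrorE/bead_ub /=; lia.
have lowest i : exists c, abacus_of l (c, i) /\ forall m, abacus_of l (m, i) -> m <= c.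
  have [m mi] := ex_bead i.
  have [c ci cmax] :=
    int_max (P := fun m => abacus_of l (m, i)) mi (bead_ub ^~ i).
  by exists c.
split=> i; first by have [m mi] := ex_bead i; exists (m, i).
have [c [ci cmax]] := lowest i.
(* The second witness mirrors [(c + 1, i)], the first gap of runner [i]. A bead at a larger level
   there would mirror to a gap of runner [i] at level at most [c], against flushness. *)
exists (c, i), (- c, rev_ord i); split.
- split=> // -[m j] /= mj ji; rewrite ji in mj *; rewrite ler_label_runner.
  exact: cmax.
- split=> //.
    have -> : (- c, rev_ord i) = mirror (c + 1, i) by congr pair; rewrite /=; lia.
    by apply/mirrorE => /cmax; lia.
  move=> [m j] /= mj ji; rewrite {j}ji in mj *.
  rewrite ler_label_runner leNgt; apply/negP => cm.
  have gap_i : gap (abacus_of l) (1 - m, i).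
    apply/mirrorE; suff -> : mirror (1 - m, i) = (m, rev_ord i) by [].
    by congr pair; rewrite /=; lia.
  have [cE|cN] := eqVneq (1 - m) c; first by apply: gap_i; rewrite cE.
  by apply: (fl _ _ ci gap_i) => //; rewrite /precedes ltr_label_runner; lia.
- rewrite /label /abacus_N /=; have := ltn_ord i; nia.
Qed.

(** Flushness reduces runner [i] to the level [c i] of its lowest bead, and balance becomes
    [c (rev_ord i) = - c i], which is the symmetry required by [maya_partition]. *)
Lemma balanced_flush_abacus_of a : balanced a -> flush a ->
  exists l, [/\ is_partition l, symmetric_partition l & a = abacus_of l].
Proof.
move=> [_ bal] fl.
have /choice[c c_low] : forall i, exists m, lowest_bead a i (m, i).
  move=> i; have [[m j] [f [lb _ _]]] := bal i.
  by have [_ /= ji _] := lb; exists m; rewrite -{2}ji.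
have aE m i : a (m, i) <-> m <= c i.
  have [ci _ c_max] := c_low i; split=> [mi|mc].
    by have := c_max _ mi erefl; rewrite ler_label_runner.
  apply: contrapT => gmi; move: mc; rewrite le_eqVlt => /orP[/eqP mc|mc].
    by apply: gmi; rewrite mc.
  by apply: (fl _ _ ci gmi) => //; rewrite /precedes ltr_label_runner.
have c_rev i : c (rev_ord i) = - c i.
  have [e [f [[ae ei e_max] [af fi f_max] ef]]] := bal i.
  have eE : e = (c i, i).
    case: e ei ae e_max {ef} => m j /= -> /aE mc e_max; congr pair; apply: le_anti.
    have /e_max : a (c i, i) by apply/aE.
    by rewrite ler_label_runner mc => /(_ erefl) ->.
  have fE : f = (c (rev_ord i), rev_ord i).
    case: f fi af f_max {ef} => m j /= -> /aE mc f_max; congr pair; apply: le_anti.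
    have /f_max : a (c (rev_ord i), rev_ord i) by apply/aE.
    by rewrite ler_label_runner mc => /(_ erefl) ->.
  move: ef; rewrite eE fE /label /abacus_N /=; have := ltn_ord i; nia.
(* Every entry of level at most [-C] is a bead, hence so is every position below [-C * 2n]. *)
pose C := (\max_i absz (c i))%N.
have [|q qK|l pl lE] := @maya_partition (fun q => `[< a (entry_at q) >])
    (C * (2 * n))%N.
- move=> q; rewrite -[q]entry_atK -pos_mirror !posK.
  case: (entry_at q) => m i; rewrite -asbool_neg /mirror; apply: asbool_equiv_eq.
  by rewrite !aE c_rev /=; lia.
- apply/asboolP; case eq_q : (entry_at q) => [m i]; apply/aE.
  have c_le : (absz (c i) <= C)%N by apply: (leq_bigmax (F := fun i => absz (c i))).
  rewrite leNgt; apply/negP => mc.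
  have : 0 <= (m - 1 + C%:Z) * (2 * n)%N%:Z by apply: mulr_ge0; lia.
  by have := entry_atK q; rewrite eq_q /pos /= mulrDl; lia.
have sl : sorted geq l by case/andP: pl.
have aE' : a = abacus_of l.
  apply/seteqP; split=> e; rewrite /abacus_of /=.
    by move=> ae; apply/lE/asboolP; rewrite posK.
  by move=> /lE/asboolP; rewrite posK.
exists l; split=> //; apply/symmetric_partitionP => // q.
have beadE q' : (exists i, q' = bead_pos l i) <-> a (entry_at q').
  by rewrite aE' /abacus_of /= entry_atK.
rewrite !beadE -[q]entry_atK -pos_mirror !posK.
by case: (entry_at q) => m i; rewrite /mirror !aE c_rev /=; split; [lia|move=> ?; lia].
Qed.

End Positions.

Theorem proposition5p4 (n : nat) (hn : (0 < n)%N) :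
  set_bij (balanced_flush_abaci n) (symmetric_cores (2 * n))
          (@abacus_partition n) /\
  set_bij (even_balanced_flush_abaci n) (even_symmetric_cores (2 * n))
          (@abacus_partition n).
Proof.
(* Both abaci have the form [abacus_of l], and their images return the respective [l]. *)
have inj : set_inj (balanced_flush_abaci n) (@abacus_partition n).
  move=> a a' /[!inE] -[ba fa] [ba' fa'].
  have [l [pl _ ->]] := balanced_flush_abacus_of hn ba fa.
  have [l' [pl' _ ->]] := balanced_flush_abacus_of hn ba' fa'.
  by rewrite !abacus_of_partitionK // => ->.
split; split=> [a|//|l].
- case=> ba fa; have [l [pl l_sym a_l]] := balanced_flush_abacus_of hn ba fa.
  have sl : sorted geq l by case/andP: pl.
  rewrite a_l abacus_of_partitionK //; split=> //.
  by apply/flush_abacus_of => //; rewrite -a_l.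
- case=> pl l_sym core; have sl : sorted geq l by case/andP: pl.
  have fl : flush (@abacus_of n l) by apply/flush_abacus_of.
  exists (@abacus_of n l); last exact: abacus_of_partitionK.
  by split=> //; apply: balanced_abacus_of.
- case=> ea ba fa; have [l [pl l_sym a_l]] := balanced_flush_abacus_of hn ba fa.
  have sl : sorted geq l by case/andP: pl.
  rewrite a_l abacus_of_partitionK //; split=> //.
    by apply/(even_abacus_of hn) => //; rewrite -a_l.
  by apply/flush_abacus_of => //; rewrite -a_l.
- by move=> a a' /[!inE] -[_ ba fa] [_ ba' fa']; apply: inj; rewrite inE.
- case=> pl even_l l_sym core; have sl : sorted geq l by case/andP: pl.
  have fl : flush (@abacus_of n l) by apply/flush_abacus_of.
  exists (@abacus_of n l); last exact: abacus_of_partitionK.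
  by split=> //; [apply/even_abacus_of|apply: balanced_abacus_of].
Qed.
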